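(* Let $i\in\{1,\dots,N\}$, $k\in\{0,\dots,T-1\}$, and let $r\ge 0$ be an integer with $k+r\le T-1$. Define $$M_{i,k}=\sum_{t=k}^{T-1}\left(A_i^{t-k}\right)^\top \Gamma_{i,t} A_i^{t-k},$$ $$\tilde\lambda_{i,k,r}=\lambda_i-\sum_{\tau=k+1}^{k+r}\ \sum_{t=\tau}^{T-1}\operatorname{tr}\!\left(\Gamma_{i,t}A_i^{t-\tau}\Sigma_i^{w}\left(A_i^{t-\tau}\right)^\top\right),$$ (the outer sum being empty if $r=0$) and $$\mathcal{E}_{i,k,r}=\{x\in\mathbb{R}^{n_i}\mid x^\top M_{i,k}x<\tilde\lambda_{i,k,r}\}.$$ If $e^s_{i,k}\in\mathcal{E}_{i,k,r}$, then in the centralized capacity-constrained scheduling problem at time $k$ (defined in the context) it is optimal to set $\theta_{i,k+\ell|k}=0$ for all $\ell=0,1,\dots,r$; that is, these decisions of agent $i$ can be fixed to zero without loss of optimality: there is an optimal solution $\{\theta_{j,t|k}\}_{1\le j\le N,\,k\le t\le T-1}$ with $\theta_{i,k|k}=\theta_{i,k+1|k}=\dots=\theta_{i,k+r|k}=0$.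
   Context: Agents and data. There are $N$ agents and a finite horizon $T\ge 1$. For each agent $j\in\{1,\dots,N\}$ we are given real matrices $A_j\in\mathbb{R}^{n_j\times n_j}$, $B_j\in\mathbb{R}^{n_j\times m_j}$, symmetric weights $Q_j\succeq 0$, $Q_{j,T}\succeq 0$, $R_j\succ 0$, a communication price $\lambda_j>0$, and process noises $w_{j,t}\in\mathbb{R}^{n_j}$ that are zero-mean with finite covariance $\Sigma_j^{w}$, i.i.d. in time, and independent across agents and across time. The network capacity $C$ is a nonnegative integer. Riccati weights. For each $j$, set $P_{j,T}=Q_{j,T}$ and, for $t=T-1,\dots,0$, $$S_{j,t}=R_j+B_j^\top P_{j,t+1}B_j,\qquad L_{j,t}=S_{j,t}^{-1}B_j^\top P_{j,t+1}A_j,$$ $$P_{j,t}=A_j^\top P_{j,t+1}A_j+Q_j-A_j^\top P_{j,t+1}B_jS_{j,t}^{-1}B_j^\top P_{j,t+1}A_j,$$ and define $\Gamma_{j,t}=L_{j,t}^\top S_{j,t}L_{j,t}\succeq 0$. Scheduling problem at time $k$. At time $k\in\{0,\dots,T-1\}$ the scheduler knows the realized prediction errors $e^s_{j,k}\in\mathbb{R}^{n_j}$, $j=1,\dots,N$, which are treated as fixed vectors; the noises $w_{j,t}$, $t\ge k$, are independent of them. The scheduler chooses deterministic (open-loop) decisions $\theta_{j,t|k}\in\{0,1\}$ for $1\le j\le N$, $k\le t\le T-1$ ($\theta_{j,t|k}=1$ means agent $j$ transmits at time $t$, $\theta_{j,t|k}=0$ means it skips) so as to minimize $$\sum_{j=1}^N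 \mathbb{E}\left[\sum_{t=k}^{T-1}\left(e_{j,t}^\top\Gamma_{j,t}e_{j,t}+\lambda_j\theta_{j,t|k}\right)\right]$$ subject to $$e_{j,k}=(1-\theta_{j,k|k})\,e^s_{j,k},\qquad e_{j,t+1}=(1-\theta_{j,t+1|k})\left(A_je_{j,t}+w_{j,t}\right)\ \text{ for } t=k,\dots,T-2,$$ for every $j$, and the capacity constraint $\sum_{j=1}^N\theta_{j,t|k}\le C$ for every $t=k,\dots,T-1$. The expectation is over the noises, given the realized $e^s_{j,k}$. A solution is optimal if it is feasible and attains the minimum. *)

(* Defs.v *)
(* MathComp-Analysis; the reals are an arbitrary [R : realType]. *)
From HB Require Import structures.
From mathcomp Require Import all_boot all_order all_algebra.
From mathcomp Require Import all_classical all_reals all_analysis.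

Set Implicit Arguments.
Unset Strict Implicit.
Unset Printing Implicit Defensive.

Import Order.TTheory GRing.Theory Num.Theory.
Import numFieldNormedType.Exports.

Local Open Scope classical_set_scope.
Local Open Scope ring_scope.

Definition qform (R : realType) (n : nat) (M : 'M[R]_n) (x : 'cV[R]_n) : R :=
  (x^T *m M *m x) 0 0.

Definition sym_psd (R : realType) (n : nat) (M : 'M[R]_n) : Prop :=
  M^T = M /\ forall x : 'cV[R]_n, 0 <= qform M x.

Definition sym_pd (R : realType) (n : nat) (M : 'M[R]_n) : Prop :=
  M^T = M /\ forall x : 'cV[R]_n, x != 0 -> 0 < qform M x.

(* Column vectors with their Borel sigma-algebra. *)
Definition borel_cV (R : realType) (n : nat) :
    measurableType (@open 'cV[R]_n).-sigma :=
  g_sigma_algebraType (@open 'cV[R]_n).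

Definition mutually_independent (d : measure_display) (Omega : measurableType d)
    (R : realType) (P : probability Omega R) (I : finType)
    (d' : I -> measure_display) (S : forall i, measurableType (d' i))
    (X : forall i, {RV P >-> S i}) : Prop :=
  forall (J : {set I}) (E : forall i, set (S i)),
    (forall i, measurable (E i)) ->
    P (\bigcap_(i in [set` J]) (X i @^-1` E i)) =
    (\prod_(i in J) P (X i @^-1` E i))%E.

Record agent (R : realType) := Agent {
  xdim : nat;
  udim : nat;
  Amx : 'M[R]_xdim;
  Bmx : 'M[R]_(xdim, udim);
  Qmx : 'M[R]_xdim;
  QTmx : 'M[R]_xdim;
  Rmx : 'M[R]_udim;
  price : R;
  noise_cov : 'M[R]_xdim
}.

Section AgentWeights.
Variables (R : realType) (a : agent R) (T : nat).

(* [stage_S], [stage_L] and [stage_P] compute S_t, L_t and P_t from P_(t+1). *)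
Definition stage_S (P : 'M[R]_(xdim a)) : 'M[R]_(udim a) :=
  Rmx a + (Bmx a)^T *m P *m Bmx a.

Definition stage_L (P : 'M[R]_(xdim a)) : 'M[R]_(udim a, xdim a) :=
  invmx (stage_S P) *m (Bmx a)^T *m P *m Amx a.

Definition stage_P (P : 'M[R]_(xdim a)) : 'M[R]_(xdim a) :=
  (Amx a)^T *m P *m Amx a + Qmx a
  - (Amx a)^T *m P *m Bmx a *m invmx (stage_S P) *m (Bmx a)^T *m P *m Amx a.

(* P_t, meaningful for t <= T: [T - t] backward steps from P_T = Q_T. *)
Definition riccati (t : nat) : 'M[R]_(xdim a) :=
  iter (T - t) stage_P (QTmx a).

Definition Gamma (t : nat) : 'M[R]_(xdim a) :=
  let S := stage_S (riccati t.+1) in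
  let L := stage_L (riccati t.+1) in
  L^T *m S *m L.

Definition skip_M (k : nat) : 'M[R]_(xdim a) :=
  \sum_(k <= t < T) (Amx a ^+ (t - k))^T *m Gamma t *m Amx a ^+ (t - k).

Definition skip_price (k r : nat) : R :=
  price a
  - \sum_(k.+1 <= tau < (k + r).+1) \sum_(tau <= t < T)
      \tr (Gamma t *m Amx a ^+ (t - tau) *m noise_cov a
             *m (Amx a ^+ (t - tau))^T).

Definition skip_set (k r : nat) : set 'cV[R]_(xdim a) :=
  [set x | qform (skip_M k) x < skip_price k r].

(* The error e_(k + s) along a noise realization [v], when the schedule is
   [theta] ([true] meaning "transmit") and the realized error at time k is
   [es]. *)
Fixpoint sched_err (k : nat) (es : 'cV[R]_(xdim a)) (theta : nat -> bool)
    (v : nat -> 'cV[R]_(xdim a)) (s : nat) : 'cV[R]_(xdim a) :=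
  match s with
  | 0 => (1 - (theta k)%:R) *: es
  | s'.+1 => (1 - (theta (k + s'.+1)%N)%:R) *:
               (Amx a *m sched_err k es theta v s' + v (k + s')%N)
  end.

Definition path_cost (k : nat) (es : 'cV[R]_(xdim a)) (theta : nat -> bool)
    (v : nat -> 'cV[R]_(xdim a)) : R :=
  \sum_(k <= t < T)
    (qform (Gamma t) (sched_err k es theta v (t - k)%N)
     + price a * (theta t)%:R).

End AgentWeights.

Section Noise.
Variables (R : realType) (d : measure_display) (Omega : measurableType d).
Variables (P : probability Omega R) (T n : nat).
Variable w : nat -> {RV P >-> borel_cV R n}.

Definition noise_coord (t : nat) (p : 'I_n) : Omega -> R :=
  fun x => (w t x : 'cV[R]_n) p 0.

(* Square integrability gives the expectations and covariances, which are
   total functions of the library, their intended meaning. *)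
Definition zero_mean_noise (Sigma : 'M[R]_n) : Prop :=
  forall t, (t < T)%N ->
    [/\ forall p, noise_coord t p \in Lfun P 2%:E,
        forall p, ('E_P[noise_coord t p] = 0)%E &
        forall p q, covariance P (noise_coord t p) (noise_coord t q)
                    = (Sigma p q)%:E].

Definition identically_distributed : Prop :=
  forall t t', (t < T)%N -> (t' < T)%N ->
    forall E : set (borel_cV R n), measurable E ->
      distribution P (w t) E = distribution P (w t') E.

End Noise.

Section Scheduling.
Variables (R : realType) (d : measure_display) (Omega : measurableType d).
Variables (P : probability Omega R) (N T C : nat) (a : 'I_N -> agent R).
Variable w : forall j, nat -> {RV P >-> borel_cV R (xdim (a j))}.
Variables (k : nat) (es : forall j, 'cV[R]_(xdim (a j))).

(* A schedule is a total function of time; only its values at times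
   k <= t < T matter. *)
Definition feasible (theta : 'I_N -> nat -> bool) : Prop :=
  forall t, (k <= t < T)%N -> (\sum_(j < N) theta j t <= C)%N.

Definition expected_cost (theta : 'I_N -> nat -> bool) : \bar R :=
  (\sum_(j < N)
     'E_P[fun x => path_cost T k (es j) (theta j) (fun t => w j t x)])%E.

Definition optimal (theta : 'I_N -> nat -> bool) : Prop :=
  feasible theta /\
  forall theta', feasible theta' ->
    (expected_cost theta <= expected_cost theta')%E.

End Scheduling.

(* Main.v *)
Require Import Defs.
From HB Require Import structures.
From mathcomp Require Import all_boot all_order all_algebra.
From mathcomp Require Import all_classical all_reals all_analysis.
From mathcomp Require Import measurable_realfun lra.

(** Independence makes the second moment of the error evolve by the linear
    recursion X -> (1 - theta) (A X A^T + Sigma), so the expected cost of an agent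
    is a deterministic function of its schedule. Start from an optimal schedule,
    which exists because only finitely many decisions matter. If agent i transmits
    at some time in [k, k + r], drop all its transmissions there: this keeps the
    capacity constraints and saves at least one price lambda. The error
    covariance at time t grows by at most the contribution of e^s and of the
    noises entering the error at times k + 1, ..., k + r, as later noises are
    treated alike by both schedules; weighted by Gamma and summed over t, this is
    x^T M x + lambda - lambda~, which is less than lambda on the skip set. *)

Set Implicit Arguments.
Unset Strict Implicit.
Unset Printing Implicit Defensive.

Import Order.TTheory GRing.Theory Num.Theory.
Import numFieldNormedType.Exports.

Local Open Scope classical_set_scope.
Local Open Scope ring_scope.

(** * Expectation of a product of independent variables *)

Section Independence.
Context d (Omega : measurableType d) (R : realType) (P : probability Omega R).

(** Independence says that the law of the pair agrees with the product of the two laws on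
    rectangles, hence everywhere. The expectation becomes an integral against a product measure, and
    Fubini splits it. *)
Lemma expectationM_indep (X Y : {RV P >-> R}) :
    (X : Omega -> R) \in Lfun P 1 -> (Y : Omega -> R) \in Lfun P 1 ->
    ((X : Omega -> R) \* Y) \in Lfun P 1 ->
    (forall A B, measurable A -> measurable B ->
      P (X @^-1` A `&` Y @^-1` B) = (P (X @^-1` A) * P (Y @^-1` B))%E) ->
  ('E_P[X \* Y] = 'E_P[X] * 'E_P[Y])%E.
Proof.
move=> X1 Y1 XY1 indep.
have mZ : measurable_fun [set: Omega] (fun x => (X x, Y x)).
  exact: measurable_fun_pair.
pose Z : {RV P >-> (R * R)%type} :=
  HB.pack (fun x => (X x, Y x)) (isMeasurableFun.Build _ _ _ _ _ mZ).
pose f (z : R * R) : \bar R := (z.1 * z.2)%:E.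
have mf : measurable_fun [set: R * R] f.
  by apply/measurable_EFinP; apply: measurable_funM.
have prodE U : measurable U ->
    (distribution P X \x distribution P Y)%E U = distribution P Z U.
  by apply: product_measure_unique => A B mA mB; exact: indep.
have intfZ : P.-integrable [set: Omega] (f \o Z) by exact/Lfun1_integrable.
have intf : (distribution P X \x distribution P Y)%E.-integrable [set: R * R] f.
  apply/integrableP; split=> //.
  rewrite (@eq_measure_integral _ _ _ _ (distribution P Z)); last first.
    by move=> U mU _; exact: prodE.
  rewrite ge0_integral_distribution//; last exact: measurableT_comp.
  by case/integrableP : intfZ.
have -> : ('E_P[X \* Y] = \int[(distribution P X \x distribution P Y)]_z f z)%E.
  rewrite (@eq_measure_integral _ _ _ _ (distribution P Z)); last first.
    by move=> U mU _; exact: prodE.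
  by rewrite integral_distribution// unlock.
have mid : measurable_fun [set: R] (@EFin R) by exact: EFin_measurable.
rewrite -integral12_prod_meas1//.
have iPX : P.-integrable [set: Omega] (EFin \o X) by exact/Lfun1_integrable.
have iPY : P.-integrable [set: Omega] (EFin \o Y) by exact/Lfun1_integrable.
have EX : (\int[distribution P X]_x x%:E = 'E_P[X])%E.
  by rewrite integral_distribution// unlock.
have EY : (\int[distribution P Y]_y y%:E = 'E_P[Y])%E.
  by rewrite integral_distribution// unlock.
have iX : (distribution P X).-integrable [set: R] (@EFin R).
  exact: integrable_pushforward.
have iY : (distribution P Y).-integrable [set: R] (@EFin R).
  exact: integrable_pushforward.
rewrite /fubini_F /f /=.
under eq_integral => x _.
  under eq_integral do rewrite EFinM.
  rewrite integralZl// EY.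
  over.
rewrite -EX -(fineK (expectation_fin_num Y1)).
by rewrite integralZr.
Qed.
End Independence.

(** * Second moments of square-integrable random vectors *)

Section SecondMoments.
Context d (Omega : measurableType d) (R : realType) (P : probability Omega R).

Lemma Lfun_lincomb (r : R) (I : Type) (s : seq I) (c : I -> R)
    (F : I -> Omega -> R) : 1 <= r ->
  (forall i, F i \in Lfun P r%:E) ->
  (fun x => \sum_(i <- s) c i * F i x) \in Lfun P r%:E.
Proof.
move=> r1 FL; elim: s => [|i s IH].
  under eq_fun do rewrite big_nil.
  exact: Lfun_cst.
under eq_fun do rewrite big_cons mulrC.
have r1E : (1 <= r%:E)%E by rewrite lee_fin.
have [_ addL] := Lfun_addr_closed P r1E.
by apply: (addL (c i \o* F i)) => //; exact: Lfun_scale.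
Qed.

Lemma expectation_lincomb (I : Type) (s : seq I) (c : I -> R)
    (F : I -> Omega -> R) : (forall i, F i \in Lfun P 1) ->
  'E_P[(fun x => \sum_(i <- s) c i * F i x)%R]%E =
  (\sum_(i <- s) c i * fine 'E_P[F i]%E)%:E.
Proof.
move=> FL; elim: s => [|i s IH].
  under eq_fun do rewrite big_nil.
  by rewrite big_nil; exact: expectation_cst.
under eq_fun do rewrite big_cons mulrC.
rewrite (expectationD (X := c i \o* F i)); last 2 first.
- exact: Lfun_scale.
- exact: Lfun_lincomb.
by rewrite expectationZl// IH big_cons EFinD EFinM fineK// expectation_fin_num.
Qed.

Definition square_integrable n (V : Omega -> 'cV[R]_n) :=
  forall p, (fun x => V x p 0) \in Lfun P 2%:E.

(** For square-integrable vectors these expectations are finite, so [fine] loses nothing. *)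
Definition cross_moment n m (V : Omega -> 'cV[R]_n) (W : Omega -> 'cV[R]_m) :
    'M[R]_(n, m) :=
  \matrix_(p, q) fine 'E_P[(fun x => V x p 0 * W x q 0)%R]%E.

Lemma square_integrable_cst n (v : 'cV[R]_n) : square_integrable (cst v).
Proof. by move=> p; exact: Lfun_cst. Qed.

Lemma square_integrable_affine n m (A : 'M[R]_(n, m)) V W :
  square_integrable V -> square_integrable W ->
  square_integrable (fun x => A *m V x + W x).
Proof.
move=> VL WL p.
have r1E : (1 <= 2%:E :> \bar R)%E by rewrite lee_fin ler1n.
have [_ addL] := Lfun_addr_closed P r1E.
under eq_fun do rewrite mxE mxE.
apply: (addL (fun x => \sum_j A p j * V x j 0)); last exact: WL.
by apply: Lfun_lincomb => //; rewrite ler1n.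
Qed.

Lemma square_integrableM n m (V : Omega -> 'cV[R]_n) (W : Omega -> 'cV[R]_m) p q :
  square_integrable V -> square_integrable W ->
  (fun x => V x p 0 * W x q 0) \in Lfun P 1.
Proof. by move=> VL WL; exact: Lfun2_mul_Lfun1 (VL p) (WL q). Qed.

Lemma cross_momentC n m (V : Omega -> 'cV[R]_n) (W : Omega -> 'cV[R]_m) :
  cross_moment W V = (cross_moment V W)^T.
Proof.
by apply/matrixP => p q; rewrite !mxE; under eq_fun do rewrite mulrC.
Qed.

Lemma cross_moment_affinel n m l (A : 'M[R]_(n, m)) V W (U : Omega -> 'cV[R]_l) :
  square_integrable V -> square_integrable W -> square_integrable U ->
  cross_moment (fun x => A *m V x + W x) U =
  A *m cross_moment V U + cross_moment W U.
Proof.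
move=> VL WL UL; apply/matrixP => p q; rewrite !mxE.
under eq_fun do rewrite mxE mxE mulrDl mulr_suml.
rewrite (expectationD (X := fun x => \sum_j A p j * V x j 0 * U x q 0)).
- under eq_fun do under eq_bigr do rewrite -mulrA.
  rewrite (expectation_lincomb _ _ (F := fun j x => V x j 0 * U x q 0)).
    rewrite fineD//; last by rewrite expectation_fin_num// square_integrableM.
    by congr (_ + _); apply: eq_bigr => j _; rewrite mxE.
  by move=> j; exact: square_integrableM.
- under eq_fun do under eq_bigr do rewrite -mulrA.
  by apply: Lfun_lincomb => // j; exact: square_integrableM.
- exact: square_integrableM.
Qed.

(** The mixed terms of the bilinear expansion vanish. Taking the error for [V] and the noise for
    [W], this is one step of the covariance recursion. *)
Lemma cross_moment_affine n m (A : 'M[R]_(n, m)) V W :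
  square_integrable V -> square_integrable W -> cross_moment V W = 0 ->
  cross_moment (fun x => A *m V x + W x) (fun x => A *m V x + W x) =
  A *m cross_moment V V *m A^T + cross_moment W W.
Proof.
move=> VL WL VW0; have AVWL := square_integrable_affine A VL WL.
set U := fun x => _ in AVWL *.
have UV : cross_moment U V = A *m cross_moment V V.
  by rewrite cross_moment_affinel// (cross_momentC V W) VW0 trmx0 addr0.
have UW : cross_moment U W = cross_moment W W.
  by rewrite cross_moment_affinel// VW0 mulmx0 add0r.
rewrite {1}/U cross_moment_affinel// (cross_momentC U V) (cross_momentC U W).
by rewrite UV UW trmx_mul -!cross_momentC mulmxA.
Qed.

(** A single sum over index pairs has the shape that the linear-combination lemmas accept. *)
Lemma qform_sum n (G : 'M[R]_n) x :
  qform G x = \sum_(pq : 'I_n * 'I_n) G pq.1 pq.2 * (x pq.1 0 * x pq.2 0).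
Proof.
rewrite -(pair_bigA _ (fun p q => G p q * (x p 0 * x q 0))) exchange_big /=.
rewrite /qform mxE; apply: eq_bigr => q _.
rewrite mxE mulr_suml; apply: eq_bigr => p _.
by rewrite mxE mulrCA mulrA.
Qed.

Lemma Lfun_qform n (G : 'M[R]_n) V :
  square_integrable V -> (fun x => qform G (V x)) \in Lfun P 1.
Proof.
move=> VL; under eq_fun do rewrite qform_sum.
apply: (Lfun_lincomb _ _ (F := fun pq x => V x pq.1 0 * V x pq.2 0)) => // pq.
exact: square_integrableM.
Qed.

Lemma expectation_qform n (G : 'M[R]_n) V : square_integrable V ->
  'E_P[fun x => qform G (V x)]%E = (\tr (G *m cross_moment V V))%:E.
Proof.
move=> VL; under eq_fun do rewrite qform_sum.
rewrite (expectation_lincomb _ _ (F := fun pq x => V x pq.1 0 * V x pq.2 0)).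
  congr EFin; rewrite (cross_momentC V V) /mxtrace.
  rewrite -(pair_bigA _ (fun p q =>
    G p q * fine 'E_P[(fun x => V x p 0 * V x q 0)%R]%E)) /=.
  by apply: eq_bigr => p _; rewrite mxE; apply: eq_bigr => q _; rewrite !mxE.
by move=> pq; exact: square_integrableM.
Qed.

End SecondMoments.

(** * From independence to uncorrelated noises *)

Section Uncorrelated.
Context d (Omega : measurableType d) (R : realType) (P : probability Omega R).

Lemma measurable_coord n p :
  measurable_fun [set: borel_cV R n] (fun x : 'cV[R]_n => x p 0).
Proof.
apply: (measurability _ (RGenOpens.measurableE R)) => _ [_ [a [b ->]] <-].
rewrite setTI; apply: sub_sigma_algebra.
apply: open_comp; last exact: interval_open.
by move=> x _; exact: coord_continuous.
Qed.

Lemma cross_moment_indep n m (V : {RV P >-> borel_cV R n})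
    (W : {RV P >-> borel_cV R m}) :
  square_integrable P (V : Omega -> 'cV[R]_n) ->
  square_integrable P (W : Omega -> 'cV[R]_m) ->
  (forall p, 'E_P[fun x => (V x : 'cV[R]_n) p 0%R] = 0)%E ->
  (forall A B, measurable A -> measurable B ->
    P (V @^-1` A `&` W @^-1` B) = (P (V @^-1` A) * P (W @^-1` B))%E) ->
  cross_moment P (V : Omega -> 'cV[R]_n) (W : Omega -> 'cV[R]_m) = 0.
Proof.
move=> VL WL V0 indep; apply/matrixP => p q; rewrite !mxE.
pose fX x := (V x : 'cV[R]_n) p 0; pose fY x := (W x : 'cV[R]_m) q 0.
have mX : measurable_fun [set: Omega] fX.
  exact: measurableT_comp (measurable_coord p) (measurable_funP V).
have mY : measurable_fun [set: Omega] fY.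
  exact: measurableT_comp (measurable_coord q) (measurable_funP W).
pose X : {RV P >-> R} := HB.pack fX (isMeasurableFun.Build _ _ _ _ _ mX).
pose Y : {RV P >-> R} := HB.pack fY (isMeasurableFun.Build _ _ _ _ _ mY).
have L21 := Lfun_subset12 (fin_num_measure P setT measurableT).
rewrite (expectationM_indep (X := X) (Y := Y)).
- by rewrite V0 mul0e.
- exact/L21/VL.
- exact/L21/WL.
- exact: square_integrableM.
move=> A B mA mB.
apply: (indep ((fun v : 'cV[R]_n => v p 0) @^-1` A)
              ((fun v : 'cV[R]_m => v q 0) @^-1` B)).
- by rewrite -[X in measurable X]setTI; exact: measurable_coord.
- by rewrite -[X in measurable X]setTI; exact: measurable_coord.
Qed.

Lemma mutually_independent_pair (I J : finType) (d' : I -> measure_display)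
    (S : forall i, measurableType (d' i)) (X : forall i, J -> {RV P >-> S i})
    (i : I) (t u : J) (A B : set (S i)) :
  mutually_independent (fun p : I * J => X p.1 p.2) -> t != u ->
  measurable A -> measurable B ->
  P (X i t @^-1` A `&` X i u @^-1` B) =
    (P (X i t @^-1` A) * P (X i u @^-1` B))%E.
Proof.
move=> indep tu mA mB.
(* Mutual independence asks for an event in [S p.1] at every [p], so [A] and [B] are transported
   along [i = p.1]. Only the values at [(i, t)] and [(i, u)] matter. *)
pose E (p : I * J) : set (S p.1) :=
  match i =P p.1 with
  | ReflectT e => eq_rect i (fun j => set (S j)) (if p.2 == t then A else B) _ e
  | ReflectF _ => setT
  end.
have mE p : measurable (E p).
  case: p => j v; rewrite /E /=; case: (i =P j) => [e|_] //.
  by case: _ / e => /=; case: ifP.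
have EE v : E (i, v) = if v == t then A else B.
  (* Equality on a finite type is decidable, so proofs of [i = i] are trivial and the transport
     disappears. *)
  by rewrite /E /=; case: (i =P i) => // e; rewrite (eq_axiomK e).
have neq : (i, t) != (i, u) by rewrite xpair_eqE eqxx.
have := indep [set (i, t); (i, u)]%SET E mE.
rewrite big_setU1 ?inE//= big_set1 !EE eqxx (eq_sym u) (negbTE tu) => <-.
congr (P _); apply/seteqP; split => x /=.
  move=> [xA xB] p /= /[!inE] /orP[] /eqP -> /=.
    by rewrite EE eqxx.
  by rewrite EE eq_sym (negbTE tu).
move=> xE; split.
  by have := xE (i, t); rewrite /= EE eqxx; apply; rewrite !inE eqxx.
have := xE (i, u); rewrite /= EE eq_sym (negbTE tu); apply.
by rewrite !inE eqxx orbT.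
Qed.

End Uncorrelated.

(** * Semidefiniteness of the Riccati weights *)

Section Riccati.
Context (R : realType).

Lemma qform_congr n m (G : 'M[R]_n) (B : 'M[R]_(n, m)) x :
  qform (B^T *m G *m B) x = qform G (B *m x).
Proof. by rewrite /qform trmx_mul !mulmxA. Qed.

Lemma qformD n (G H : 'M[R]_n) x : qform (G + H) x = qform G x + qform H x.
Proof. by rewrite /qform mulmxDr mulmxDl mxE. Qed.

Lemma qform_trace n (G : 'M[R]_n) x : qform G x = \tr (G *m (x *m x^T)).
Proof. by rewrite /qform -trace_mx11 -mulmxA mxtrace_mulC mulmxA. Qed.

Lemma sym_psdD n (G H : 'M[R]_n) : sym_psd G -> sym_psd H -> sym_psd (G + H).
Proof.
move=> [Gs G0] [Hs H0]; split; first by rewrite linearD/= Gs Hs.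
by move=> x; rewrite qformD addr_ge0.
Qed.

Lemma sym_psd_congr n m (G : 'M[R]_n) (B : 'M[R]_(n, m)) :
  sym_psd G -> sym_psd (B^T *m G *m B).
Proof.
move=> [Gs G0]; split; first by rewrite !trmx_mul Gs trmxK mulmxA.
by move=> x; rewrite qform_congr.
Qed.

Lemma sym_pd_psd n (G : 'M[R]_n) : sym_pd G -> sym_psd G.
Proof.
move=> [Gs Gp]; split=> // x; have [->|/Gp/ltW//] := eqVneq x 0.
by rewrite /qform mulmx0 mxE.
Qed.

Lemma sym_pd_unitmx n (G : 'M[R]_n) : sym_pd G -> G \in unitmx.
Proof.
move=> [_ Gp]; rewrite -row_free_unit -kermx_eq0; apply/rowV0P => v.
move=> /sub_kermxP vG; apply/eqP; apply: contraT => v0.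
have /Gp : v^T != 0 by rewrite -trmx0 (inj_eq trmx_inj).
by rewrite /qform trmxK vG mul0mx mxE ltxx.
Qed.

Context (a : agent R).
Hypotheses (Q_psd : sym_psd (Qmx a)) (R_pd : sym_pd (Rmx a)).

Lemma stage_S_pd P : sym_psd P -> sym_pd (stage_S (a := a) P).
Proof.
move=> Ppsd; have [Bs B0] := sym_psd_congr (Bmx a) Ppsd; have [Rs R0] := R_pd.
split; first by rewrite linearD/= Rs Bs.
by move=> x x0; rewrite qformD ltr_wpDr// R0.
Qed.

Lemma stage_SL P : sym_psd P ->
  stage_S P *m stage_L P = (Bmx a)^T *m P *m Amx a.
Proof.
by move=> /stage_S_pd/sym_pd_unitmx Su; rewrite /stage_L -!mulmxA mulKVmx.
Qed.

(** The Joseph form: with no subtracted term left outside the congruences, semidefiniteness of the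
    Riccati step can be read off. *)
Lemma stage_P_joseph P : sym_psd P ->
  let L := stage_L P in
  stage_P P = (Amx a - Bmx a *m L)^T *m P *m (Amx a - Bmx a *m L)
              + L^T *m Rmx a *m L + Qmx a.
Proof.
move=> Ppsd L.
have SL : stage_S P *m L = (Bmx a)^T *m P *m Amx a by exact: stage_SL.
have -> : stage_P P = (Amx a)^T *m P *m Amx a + Qmx a
    - (Amx a)^T *m P *m Bmx a *m L by rewrite /stage_P /L /stage_L !mulmxA.
(* From S L = B^T P A and S = R + B^T P B. This is exactly the excess left by expanding the
   congruence by A - B L. *)
have RL : L^T *m Rmx a *m L = L^T *m ((Bmx a)^T *m P *m Amx a)
    - L^T *m ((Bmx a)^T *m P *m Bmx a *m L).
  by rewrite -SL /stage_S mulmxDl mulmxDr addrK mulmxA.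
have -> : (Amx a - Bmx a *m L)^T *m P *m (Amx a - Bmx a *m L) =
    (Amx a)^T *m P *m Amx a - (Amx a)^T *m P *m Bmx a *m L
    - (L^T *m ((Bmx a)^T *m P *m Amx a)
       - L^T *m ((Bmx a)^T *m P *m Bmx a *m L)).
  by rewrite [(_ - _)^T]linearB/= trmx_mul !mulmxBl !mulmxBr !mulmxA.
by rewrite RL subrK addrAC.
Qed.

Lemma stage_P_psd P : sym_psd P -> sym_psd (stage_P (a := a) P).
Proof.
move=> Ppsd; rewrite stage_P_joseph//; apply: sym_psdD => //.
by apply: sym_psdD; apply: sym_psd_congr => //; exact: sym_pd_psd.
Qed.

Hypothesis QT_psd : sym_psd (QTmx a).

(** At times [t >= T] truncated subtraction makes the iterate equal to [QTmx a], so every [t] is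
    covered. *)
Lemma riccati_psd T t : sym_psd (riccati a T t).
Proof.
rewrite /riccati; elim: (T - t)%N => //= m IH; exact: stage_P_psd.
Qed.

Lemma Gamma_psd T t : sym_psd (Gamma a T t).
Proof.
apply: sym_psd_congr; apply/sym_pd_psd/stage_S_pd; exact: riccati_psd.
Qed.

End Riccati.

(** * The covariance recursion and the effect of dropping transmissions *)

Lemma scale_onemb (R : realType) (V : lmodType R) (b : bool) (v : V) :
  (1 - b%:R) *: v = if b then 0 else v.
Proof. by case: b; rewrite ?subrr ?scale0r// subr0 scale1r. Qed.

Section CovarianceRecursion.
Context (R : realType) (n : nat).
Implicit Types (A G X Sigma : 'M[R]_n) (theta : nat -> bool).

(* The dual cone of the nonnegative quadratic forms; working with it instead of
   the semidefinite order avoids spectral decompositions. *)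
Definition psd_dual X :=
  forall G, (forall x, 0 <= qform G x) -> 0 <= \tr (G *m X).

Lemma psd_dual0 : psd_dual 0.
Proof. by move=> G _; rewrite mulmx0 mxtrace0. Qed.

Lemma psd_dualD X Y : psd_dual X -> psd_dual Y -> psd_dual (X + Y).
Proof. by move=> hX hY G G0; rewrite mulmxDr mxtraceD addr_ge0 ?hX ?hY. Qed.

(** Cyclicity of the trace moves the congruence onto the form, which stays nonnegative. *)
Lemma psd_dual_congr A X : psd_dual X -> psd_dual (A *m X *m A^T).
Proof.
move=> hX G G0; rewrite mulmxA mxtrace_mulC !mulmxA; apply: hX => x.
by rewrite qform_congr.
Qed.

Lemma psd_dual_outer (x : 'cV[R]_n) : psd_dual (x *m x^T).
Proof. by move=> G G0; rewrite -qform_trace. Qed.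

(* The second moment of the error s steps after a start with second moment X,
   under a schedule counted from that start. *)
Fixpoint err_cov A Sigma X theta s : 'M[R]_n :=
  match s with
  | 0 => (1 - (theta 0)%:R) *: X
  | s'.+1 => (1 - (theta s'.+1)%:R) *:
               (A *m err_cov A Sigma X theta s' *m A^T + Sigma)
  end.

(* Dominates the increase of err_cov when the transmissions at the steps up to
   r are dropped. *)
Fixpoint skip_gap A Sigma X r s : 'M[R]_n :=
  match s with
  | 0 => X
  | s'.+1 => A *m skip_gap A Sigma X r s' *m A^T +
               (if (s' < r)%N then Sigma else 0)
  end.

Section Comparison.
Variables (A Sigma X : 'M[R]_n).
Hypotheses (Sigma0 : psd_dual Sigma) (X0 : psd_dual X).

Lemma psd_dual_err_cov theta s : psd_dual (err_cov A Sigma X theta s).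
Proof.
elim: s => [|s IH] /=; rewrite scale_onemb; case: ifP => _ //;
  try exact: psd_dual0.
by apply: psd_dualD => //; exact: psd_dual_congr.
Qed.

Lemma psd_dual_skip_gap r s : psd_dual (skip_gap A Sigma X r s).
Proof.
elim: s => [|s IH] //=; apply: psd_dualD; first exact: psd_dual_congr.
by case: ifP => _ //; exact: psd_dual0.
Qed.

(** Used both with steps counted from [k] (cut-off [r]) and with absolute times (cut-off
    [k + r]). *)
Definition drop_until r theta s := theta s && (r < s)%N.

(** Up to step [r] nothing resets the error and each noise is also collected by [skip_gap], so the
    two recursions coincide. *)
Lemma err_cov_drop_until r theta s : (s <= r)%N ->
  err_cov A Sigma X (drop_until r theta) s = skip_gap A Sigma X r s.
Proof.
elim: s => [|s IH] sr /=.
  by rewrite /drop_until ltn0 andbF scale_onemb.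
by rewrite {1}/drop_until ltnNge sr andbF scale_onemb IH 1?ltnW.
Qed.

(** Up to step [r] the difference is the covariance under [theta]. Beyond [r] both schedules decide
    alike: a transmission resets both covariances and leaves the gap alone, while a skip propagates
    the difference by congruence, [Sigma] cancelling. *)
Lemma skip_gap_dominates r theta s :
  psd_dual (skip_gap A Sigma X r s
    - (err_cov A Sigma X (drop_until r theta) s - err_cov A Sigma X theta s)).
Proof.
elim: s => [|s IH].
  rewrite err_cov_drop_until// opprB addrC subrK; exact: psd_dual_err_cov.
have [sr|rs] := leqP s.+1 r.
  rewrite err_cov_drop_until// opprB addrC subrK; exact: psd_dual_err_cov.
rewrite /= ltnNge -ltnS rs /= addr0 !scale_onemb {1}/drop_until rs andbT.
case: ifP => _; first by rewrite !subr0; apply/psd_dual_congr/psd_dual_skip_gap.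
rewrite [X in _ - X](_ : _ = A *m err_cov A Sigma X (drop_until r theta) s *m A^T -
  A *m err_cov A Sigma X theta s *m A^T); last first.
  by rewrite opprD addrACA subrr addr0.
by rewrite -mulmxBl -mulmxBr -mulmxBl -mulmxBr; exact: psd_dual_congr.
Qed.

(** Noise that enters at step [tau] is propagated [s - tau] times, and none is collected after step
    [r]. *)
Lemma skip_gap_closed r s : skip_gap A Sigma X r s =
  A ^+ s *m X *m (A ^+ s)^T +
  \sum_(1 <= tau < (minn s r).+1) A ^+ (s - tau) *m Sigma *m (A ^+ (s - tau))^T.
Proof.
have congrA (Y B : 'M[R]_n) :
    A *m (Y *m B *m Y^T) *m A^T = (A * Y) *m B *m (A * Y)^T.
  by rewrite -mulmxE trmx_mul !mulmxA.
elim: s => [|s IH].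
  by rewrite min0n big_nil addr0 expr0 trmx1 mul1mx mulmx1.
rewrite /= IH mulmxDr mulmxDl congrA -exprS -addrA; congr (_ + _).
rewrite mulmx_sumr mulmx_suml.
have -> : \sum_(1 <= tau < (minn s r).+1)
    A *m (A ^+ (s - tau) *m Sigma *m (A ^+ (s - tau))^T) *m A^T =
  \sum_(1 <= tau < (minn s r).+1)
    A ^+ (s.+1 - tau) *m Sigma *m (A ^+ (s.+1 - tau))^T.
  apply: eq_big_nat => tau /andP[_]; rewrite ltnS leq_min => /andP[taus _].
  by rewrite congrA -exprS subSn.
(* The new noise is the term [tau = s.+1], with exponent 0; it is present exactly when [s < r]. *)
case: ltnP => sr.
  rewrite (minn_idPl sr) [RHS]big_nat_recr//=.
  by rewrite subnn expr0 trmx1 mul1mx mulmx1.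
by rewrite addr0 (minn_idPr (leqW sr)).
Qed.

End Comparison.
End CovarianceRecursion.

(** * Expected cost of one agent as a function of its schedule *)

Section AgentCost.
Context d (Omega : measurableType d) (R : realType) (P : probability Omega R).
Context (a : agent R) (T k : nat) (es : 'cV[R]_(xdim a)).
Implicit Types (theta : nat -> bool).

Lemma cross_moment_cst n (v u : 'cV[R]_n) :
  cross_moment P (cst v) (cst u) = v *m u^T.
Proof.
apply/matrixP => p q; rewrite !mxE big_ord1 mxE.
by rewrite -[X in fine X]/('E_P[cst (v p 0 * u q 0)%R])%E expectation_cst.
Qed.

Lemma cross_moment_cstl n m (v : 'cV[R]_n) (W : Omega -> 'cV[R]_m) :
  square_integrable P W -> (forall q, 'E_P[fun x => W x q 0%R] = 0)%E ->
  cross_moment P (cst v) W = 0.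
Proof.
move=> WL W0; apply/matrixP => p q; rewrite !mxE.
under eq_fun do rewrite mulrC.
rewrite -[X in fine X]/('E_P[v p 0%R \o* (fun x => W x q 0%R)])%E.
rewrite expectationZl ?W0 ?mule0//.
exact: Lfun_subset12 (fin_num_measure P setT measurableT) _ (WL q).
Qed.

Definition moment_cost theta : R :=
  \sum_(k <= t < T)
    (\tr (Gamma a T t *m err_cov (Amx a) (noise_cov a) (es *m es^T)
                           (fun s => theta (k + s)%N) (t - k))
     + price a * (theta t)%:R).

Section Noise.
Variable w : nat -> {RV P >-> borel_cV R (xdim a)}.
Hypothesis w_moments : zero_mean_noise T w (noise_cov a).
Hypothesis w_uncorr : forall t u, (t < T)%N -> (u < T)%N -> t != u ->
  cross_moment P (w t : Omega -> 'cV[R]_(xdim a)) (w u) = 0.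

Lemma noise_square_integrable t : (t < T)%N ->
  square_integrable P (w t : Omega -> 'cV[R]_(xdim a)).
Proof. by move=> /w_moments[wL _ _] p; exact: wL. Qed.

Lemma noise_second_moment t : (t < T)%N ->
  cross_moment P (w t : Omega -> 'cV[R]_(xdim a)) (w t) = noise_cov a.
Proof.
move=> tT; have wL := noise_square_integrable tT.
have [_ w0 wcov] := w_moments tT.
have L21 := Lfun_subset12 (fin_num_measure P setT measurableT).
apply/matrixP => p q; rewrite mxE; apply: EFin_inj; rewrite -wcov.
rewrite covarianceE; last 3 first.
- exact/L21/wL.
- exact/L21/wL.
- exact: square_integrableM.
rewrite !w0 mule0 sube0 fineK//.
by apply: expectation_fin_num; exact: square_integrableM.
Qed.

Let err theta s x := sched_err k es theta (fun t => w t x) s.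

(** The error at [k + s] involves only noises before [k + s], so it is uncorrelated with the later
    ones. The induction must carry this fact, since it removes the mixed terms of the second moment
    at the next step. *)
Lemma sched_err_moments theta s : (k + s <= T)%N ->
  [/\ square_integrable P (err theta s),
      forall t, (k + s <= t < T)%N -> cross_moment P (err theta s) (w t) = 0 &
      cross_moment P (err theta s) (err theta s) =
      err_cov (Amx a) (noise_cov a) (es *m es^T) (fun s => theta (k + s)%N) s].
Proof.
(* Constant errors occur twice: at the start, and as 0 after a transmission. *)
have cstP v : [/\ square_integrable P (cst v : Omega -> 'cV[R]_(xdim a)),
    forall t, (t < T)%N -> cross_moment P (cst v) (w t) = 0 &
    cross_moment P (cst v) (cst v) = v *m v^T].
  split; [exact: square_integrable_cst| |exact: cross_moment_cst].
  move=> t tT; apply: cross_moment_cstl; first exact: noise_square_integrable.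
  by have [_] := w_moments tT.
elim: s => [|s IH] kT.
  have -> : err theta 0 = cst ((1 - (theta k)%:R) *: es) by [].
  have [sqe uncorr mom] := cstP ((1 - (theta k)%:R) *: es).
  split=> //; first by move=> t /andP[_]; exact: uncorr.
  rewrite mom /= addn0 !scale_onemb; case: ifP => // _.
  by rewrite mul0mx.
have [sqe uncorr mom] := IH (leq_trans (leq_add (leqnn k) (leqnSn s)) kT).
have ksT : (k + s < T)%N by rewrite -addnS.
rewrite /= scale_onemb.
have [thT|thF] := boolP (theta (k + s.+1)%N).
  have -> : err theta s.+1 = cst 0.
    by apply/funext => x; rewrite /err /= thT subrr scale0r.
  have [sq0 uncorr0 mom0] := cstP 0.
  split=> //; first by move=> t /andP[_]; exact: uncorr0.
  by rewrite mom0 mul0mx.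
have -> : err theta s.+1 = fun x => Amx a *m err theta s x + w (k + s)%N x.
  by apply/funext => x; rewrite /err /= (negbTE thF) subr0 scale1r.
have sqw := noise_square_integrable ksT.
have ew0 : cross_moment P (err theta s) (w (k + s)%N) = 0.
  by apply: uncorr; rewrite leqnn.
split.
- exact: square_integrable_affine.
- move=> t /andP[kst tT]; have sqt := noise_square_integrable tT.
  rewrite cross_moment_affinel// uncorr ?w_uncorr ?mulmx0 ?addr0//.
    by rewrite ltn_eqF// -addnS.
  by rewrite tT andbT (leq_trans _ kst)// addnS.
- by rewrite cross_moment_affine// mom noise_second_moment.
Qed.

Lemma expectation_path_cost theta :
  'E_P[fun x => path_cost T k es theta (fun t => w t x)]%E =
  (moment_cost theta)%:E.
Proof.
pose F t x := qform (Gamma a T t) (err theta (t - k) x) + price a * (theta t)%:R.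
pose L t := (F t \in Lfun P 1) /\ 'E_P[F t]%E =
  (\tr (Gamma a T t *m err_cov (Amx a) (noise_cov a) (es *m es^T)
          (fun s => theta (k + s)%N) (t - k)) + price a * (theta t)%:R)%:E.
have FP t : (k <= t < T)%N -> L t.
  move=> /andP[kt tT].
  have [|sqe _ mom] := @sched_err_moments theta (t - k).
    by rewrite subnKC// ltnW.
  have qL := Lfun_qform (Gamma a T t) sqe.
  have cL : cst (price a * (theta t)%:R) \in Lfun P 1 by exact: Lfun_cst.
  have [_ addL] := Lfun_addr_closed P (lexx 1%E).
  split; first exact: addL qL cL.
  rewrite (expectationD qL cL) expectation_cst EFinD; congr (_ + _)%E.
  by rewrite expectation_qform// mom.
(* Summing over a list of functions limits the integrability condition of [expectation_sum] to times
   in the horizon. *)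
have -> : (fun x => path_cost T k es theta (fun t => w t x)) =
    \sum_(f <- map F (index_iota k T)) f.
  by apply/funext => x; rewrite big_map fct_sumE.
rewrite expectation_sum; last first.
  by move=> _ /mapP[t /[!mem_index_iota] /FP[? _] ->].
rewrite big_map -sumEFin; apply: eq_big_nat => t /FP[_]; exact.
Qed.

End Noise.
End AgentCost.

(** * Price saved against error cost added *)

Section DropTransmissions.
Context (R : realType) (a : agent R) (T k : nat) (es : 'cV[R]_(xdim a)).

Lemma sum_skip_gap r :
  \sum_(k <= t < T)
    \tr (Gamma a T t *m skip_gap (Amx a) (noise_cov a) (es *m es^T) r (t - k))
  = qform (skip_M a T k) es + (price a - skip_price a T k r).
Proof.
under eq_bigr do rewrite skip_gap_closed mulmxDr mxtraceD.
rewrite big_split /=; congr (_ + _).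
  have -> : qform (skip_M a T k) es = \sum_(k <= t < T)
      qform ((Amx a ^+ (t - k))^T *m Gamma a T t *m Amx a ^+ (t - k)) es.
    apply: (big_morph (fun M => qform M es)); first by move=> *; exact: qformD.
    by rewrite /qform mulmx0 mul0mx mxE.
  apply: eq_bigr => t _; rewrite qform_congr qform_trace trmx_mul !mulmxA.
  by [].
rewrite /skip_price subKr.
pose h t tau := \tr (Gamma a T t *m Amx a ^+ (t - tau) *m noise_cov a
                       *m (Amx a ^+ (t - tau))^T).
(* Shifting [tau] by [k] turns steps up to [minn (t - k) r] into times in a range independent of
   [t], with the side condition [tau <= t]; the two sums can then be exchanged. *)
rewrite (eq_big_nat _ _ (F2 := fun t =>
    \sum_(k.+1 <= tau < (k + r).+1 | (tau <= t)%N) h t tau)); last first.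
  move=> t /andP[kt _].
  rewrite mulmx_sumr raddf_sum /= -[k.+1]add1n big_addn -addnS addKn.
  rewrite (big_nat_widen _ _ r.+1) ?ltnS ?geq_minr//=.
  apply: congr_big_nat => // tau.
    rewrite !ltnS => /andP[_ taur].
    by rewrite leq_min taur andbT leq_subRL// addnC.
  by move=> _; rewrite /h addnC subnDA !mulmxA.
rewrite (exchange_big_dep_nat (fun=> true)) //=.
apply: eq_big_nat => tau /andP[ktau _].
by rewrite [RHS](big_nat_widenl _ k)// ltnW.
Qed.

Lemma moment_cost_drop r (theta : nat -> bool) l :
  psd_dual (noise_cov a) ->
  (forall t, sym_psd (Gamma a T t)) ->
  0 <= price a -> skip_set T k r es ->
  (k + r < T)%N -> (l <= r)%N -> theta (k + l)%N ->
  moment_cost T k es (drop_until (k + r) theta) <= moment_cost T k es theta.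
Proof.
move=> Sigma0 Gpsd price0; rewrite /skip_set /= => small krT lr thl.
have dropE : (fun s => drop_until (k + r) theta (k + s)%N) =
    drop_until r (fun s => theta (k + s)%N).
  by apply/funext => s; rewrite /drop_until ltn_add2l.
rewrite /moment_cost dropE !big_split /= -!mulr_sumr.
set D := \sum_(k <= t < T) \tr (_ *m err_cov _ _ _ (drop_until _ _) _).
set E := \sum_(k <= t < T) \tr (_ *m err_cov _ _ _ _ _).
have gap : D - E <= qform (skip_M a T k) es + (price a - skip_price a T k r).
  rewrite -sum_skip_gap -sumrB; apply: ler_sum => t _.
  (* Membership in the dual cone is tested against the nonnegative form of [Gamma a T t]. *)
  rewrite -subr_ge0 -!raddfB.
  apply: skip_gap_dominates => //; first exact: psd_dual_outer.
  by case: (Gpsd t).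
have klT : (k + l < T)%N by rewrite (leq_ltn_trans _ krT)// leq_add2l.
have saved : \sum_(k <= t < T) (drop_until (k + r) theta t)%:R + 1 <=
    \sum_(k <= t < T) (theta t)%:R :> R.
  have le_drop m n : \sum_(m <= t < n) (drop_until (k + r) theta t)%:R <=
      \sum_(m <= t < n) (theta t)%:R :> R.
    apply: ler_sum => t _; rewrite ler_nat /drop_until.
    by case: (theta t) => //=; exact: leq_b1.
  (* Split at [k + l], where [theta] transmits and the reduced schedule does not; elsewhere the
     latter never transmits more. *)
  rewrite !(big_cat_nat (leq_addr l k) (ltnW klT))/=.
  rewrite ![\sum_(k + l <= t < T) _]big_ltn// thl {2}/drop_until.
  rewrite ltn_add2l ltnNge lr andbF.
  rewrite mulr0n mulr1n; have := le_drop k (k + l)%N.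
  by have := le_drop (k + l).+1 T; lra.
have := ler_wpM2l price0 saved.
(* By [small] the bound in [gap] is below one price, which is at most what [saved] recovers. *)
by rewrite mulrDr mulr1; move: gap small; lra.
Qed.
End DropTransmissions.

(** * Existence of an optimal schedule *)

Section OptimalSchedule.
Context d (Omega : measurableType d) (R : realType) (P : probability Omega R).
Context (N T C : nat) (a : 'I_N -> agent R).
Context (w : forall j, nat -> {RV P >-> borel_cV R (xdim (a j))}).
Context (k : nat) (es : forall j, 'cV[R]_(xdim (a j))).

Lemma sched_err_ext (b : agent R) (x : 'cV[R]_(xdim b)) theta theta' v s :
  (forall t, (k <= t <= k + s)%N -> theta t = theta' t) ->
  sched_err k x theta v s = sched_err k x theta' v s.
Proof.
elim: s => [|s IH] eqth /=; first by rewrite eqth// leqnn leq_addr.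
rewrite eqth ?leq_addr ?leqnn// IH// => t /andP[kt ts].
by rewrite eqth// kt (leq_trans ts)// leq_add2l.
Qed.

Lemma path_cost_ext (b : agent R) (x : 'cV[R]_(xdim b)) theta theta' v :
  (forall t, (k <= t < T)%N -> theta t = theta' t) ->
  path_cost T k x theta v = path_cost T k x theta' v.
Proof.
move=> eqth; apply: eq_big_nat => t /andP[kt tT].
rewrite eqth ?kt// (@sched_err_ext _ _ _ theta')// => u /andP[ku].
by rewrite subnKC// => ut; rewrite eqth// ku (leq_ltn_trans ut).
Qed.

Lemma exists_optimal : exists theta, optimal T C w k es theta.
Proof.
(* Schedules on the horizon form a finite type, where a minimizer exists; [false] is the default at
   times from [T] on. The schedule that never transmits shows that the feasible set is nonempty. *)
pose sched (f : {ffun 'I_N * 'I_T -> bool}) j t :=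
  if insub t is Some u then f (j, u) else false.
pose feas f :=
  [forall t : 'I_T, (k <= t)%N ==> (\sum_(j < N) sched f j t <= C)%N].
have feasP f : reflect (feasible T C k (sched f)) (feas f).
  apply: (iffP forallP) => [h t /andP[kt tT]|h t].
    by have := h (Ordinal tT); rewrite /= kt.
  by apply/implyP => kt; apply: h; rewrite kt ltn_ord.
have feas0 : feas [ffun=> false].
  apply/forallP => t; apply/implyP => _; rewrite big1// => j _.
  by rewrite /sched; case: insub => // u; rewrite ffunE.
case: (arg_minP (fun f => expected_cost T w k es (sched f)) feas0)
  => f /feasP ff fmin.
exists (sched f); split=> // theta ftheta.
pose g : {ffun 'I_N * 'I_T -> bool} := [ffun p : 'I_N * 'I_T => theta p.1 p.2].
have gE j t : (t < T)%N -> sched g j t = theta j t.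
  by move=> tT; rewrite /sched insubT ffunE.
have -> : expected_cost T w k es theta = expected_cost T w k es (sched g).
  apply: eq_bigr => j _; congr expectation; apply/funext => x.
  by apply: path_cost_ext => t /andP[_ tT]; rewrite gE.
apply/fmin/feasP => t /andP[kt tT].
by under eq_bigr do rewrite gE//; apply: ftheta; rewrite kt.
Qed.

End OptimalSchedule.

(** * Optimality of skipping up to step [r] *)

Theorem lemma1 (R : realType) (d : measure_display) (Omega : measurableType d)
    (P : probability Omega R) (N T C : nat) (a : 'I_N -> agent R)
    (w : forall j, nat -> {RV P >-> borel_cV R (xdim (a j))})
    (T_ge1 : (1 <= T)%N)
    (Q_psd : forall j, sym_psd (Qmx (a j)))
    (QT_psd : forall j, sym_psd (QTmx (a j)))
    (R_pd : forall j, sym_pd (Rmx (a j)))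
    (price_gt0 : forall j, (0 < price (a j))%R)
    (w_moments : forall j, zero_mean_noise T (w j) (noise_cov (a j)))
    (w_ident : forall j, identically_distributed T (w j))
    (w_indep : mutually_independent (fun p : 'I_N * 'I_T => w p.1 p.2))
    (k : nat) (k_lt : (k < T)%N)
    (es : forall j, 'cV[R]_(xdim (a j)))
    (i : 'I_N) (r : nat) (kr_lt : (k + r < T)%N) :
  skip_set T k r (es i) ->
  exists theta : 'I_N -> nat -> bool,
    optimal T C w k es theta /\
    forall l : nat, (l <= r)%N -> theta i (k + l)%N = false.
Proof.
move=> small; have [theta [ftheta theta_opt]] := exists_optimal T C w k es.
have [/existsP[l thl]|] := boolP [exists l : 'I_r.+1, theta i (k + l)%N];
  last first.
  move=> /existsPn noth; exists theta; split=> // l lr.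
  by apply/negbTE; exact: (noth (Ordinal (lr : (l < r.+1)%N))).
pose theta' j := if j == i then drop_until (k + r) (theta j) else theta j.
exists theta'; split; last first.
  by move=> l' lr; rewrite /theta' eqxx /drop_until ltn_add2l ltnNge lr andbF.
split.
  move=> t kt; apply: leq_trans (ftheta t kt); apply: leq_sum => j _.
  rewrite /theta' /drop_until; case: eqP => // _.
  by case: (theta j t) => //=; exact: leq_b1.
(* It suffices that [theta'] costs no more than [theta], and only the term of agent [i] differs. *)
move=> theta2 /theta_opt; apply: le_trans; apply: lee_sum => j _.
rewrite /theta'; case: eqP => [->|_] //.
have noise_uncorr t u : (t < T)%N -> (u < T)%N -> t != u ->
    cross_moment P (w i t : Omega -> 'cV[R]_(xdim (a i))) (w i u) = 0.
  move=> tT uT tu; have [_ w0 _] := w_moments i _ tT.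
  apply: cross_moment_indep => //.
  - exact: noise_square_integrable (w_moments i) _ tT.
  - exact: noise_square_integrable (w_moments i) _ uT.
  move=> A B mA mB.
  exact: (mutually_independent_pair (X := fun j (v : 'I_T) => w j v)
    (t := Ordinal tT) (u := Ordinal uT)).
rewrite !expectation_path_cost// lee_fin.
apply: (@moment_cost_drop _ _ _ _ _ _ _ l) => //.
(* The noise covariance lies in the dual cone because it is the second moment of the noise at time
   [k]: its trace against [G] is the expectation of a nonnegative variable. *)
- move=> G G0; rewrite -(noise_second_moment (w_moments i) k_lt).
  rewrite -lee_fin -expectation_qform; last first.
    exact: noise_square_integrable (w_moments i) _ k_lt.
  by apply: expectation_ge0 => x; exact: G0.
- by move=> t; exact: Gamma_psd.
- exact: ltW.
- exact: (ltn_ord l).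
Qed.
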